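(* Let $\theta\ge 1$ be an integer, let $\alpha_1,\dots,\alpha_\theta\in\mathbb{C}^\theta$ be linearly independent vectors (the screening momenta), and let $u.v=\sum_{s=1}^{\theta}u_sv_s$ denote the (complex-bilinear) Euclidean scalar product on $\mathbb{C}^\theta$. Let $(a_{i,j})_{1\le i,j\le\theta}$ be a generalized Cartan matrix (in particular, an integer matrix with $a_{i,i}=2$) such that for each pair $i\ne j$ $$2\,\alpha_i.\alpha_j=a_{i,j}\,\alpha_i.\alpha_i\qquad\text{or}\qquad (1-a_{i,j})\,\alpha_i.\alpha_i=2 .$$ Let $c$ be the central charge of the Virasoro algebra centralizing the $\theta$ screenings $\oint e^{\alpha_i.\varphi}$, $1\le i\le\theta$, in the $\theta$-boson space. Then $c$ is invariant under the Weyl reflections: for every $k\in\{1,\dots,\theta\}$, $\mathfrak{R}^{(k)}(c)=c$, where $\mathfrak{R}^{(k)}(c)$ is the central charge obtained by replacing, in the system of equations and the formula defining $c$, every scalar product $\alpha_i.\alpha_j$ ($1\le i,j\le\theta$) with $$\mathfrak{R}^{(k)}(\alpha_i.\alpha_j)=\alpha_i.\alpha_j-a_{k,j}\,\alpha_i.\alpha_k-a_{k,i}\,\alpha_k.\alpha_j+a_{k,i}a_{k,j}\,\alpha_k.\alpha_k .$$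
   Context: **Bosons and screenings.** $\varphi(z)=(\varphi^1(z),\dots,\varphi^\theta(z))$ are $\theta$ bosonic fields with OPEs $\varphi^i(z)\varphi^j(w)=\delta^{ij}\log(z-w)$. Their energy--momentum tensors are parameterized by $\xi\in\mathbb{C}^\theta$: $T_\xi(z)=\tfrac12\partial\varphi(z).\partial\varphi(z)+\xi.\partial^2\varphi(z)$; the modes of $T_\xi$ generate a Virasoro algebra with central charge $c_\xi=\theta-12\,\xi.\xi$. With respect to $T_\xi$, the vertex operator $e^{\mu.\varphi(z)}$, $\mu\in\mathbb{C}^\theta$, has dimension $\Delta=\tfrac12\mu.\mu-\xi.\mu$. An operator $\oint e^{\mu.\varphi}$ is a screening with respect to $T_\xi$ if $e^{\mu.\varphi(z)}$ has dimension $\Delta=1$. **Central charge $c$ of the Virasoro algebra centralizing the screenings.** This is $c=c_\xi$ for the unique $\xi$ such that every $e^{\alpha_i.\varphi(z)}$ has dimension $1$, i.e. $\tfrac12\alpha_i.\alpha_i-\xi.\alpha_i=1$ for $1\le i\le\theta$. Writing $\xi=\sum_{j=1}^\theta x_j\alpha_j$, this is the system $$\tfrac12\,\alpha_i.\alpha_i-\sum_{j=1}^{\theta}x_j\,\alpha_j.\alpha_i=1,\qquad 1\le i\le\theta,$$ which is uniquely solvable for $(x_j)$ because the $\alpha_i$ are linearly independent, and $$c=\theta-12\sum_{\ell,j=1}^{\theta}x_\ell x_j\,\alpha_\ell.\alpha_j .$$ **Reflected central charge.** Explicitly, $\mathfrak{R}^{(k)}(c)=\theta-12\sum_{\ell,j=1}^{\theta}\tilde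 x_\ell\tilde x_j\,\mathfrak{R}^{(k)}(\alpha_\ell.\alpha_j)$, where $(\tilde x_j)$ is the solution of $$\tfrac12\,\mathfrak{R}^{(k)}(\alpha_i.\alpha_i)-\sum_{j=1}^{\theta}\tilde x_j\,\mathfrak{R}^{(k)}(\alpha_j.\alpha_i)=1,\qquad 1\le i\le\theta .$$ Here $\mathfrak{R}^{(k)}(\alpha_i.\alpha_j)$ is the scalar product of the pseudoreflected vectors $\alpha_i-a_{k,i}\alpha_k$ and $\alpha_j-a_{k,j}\alpha_k$. **Relation to Nichols algebras (interpretation only).** The momenta are related to a diagonal braiding matrix $(q_{i,j})$ by $e^{i\pi\alpha_i.\alpha_i}=q_{i,i}$ and $e^{2i\pi\alpha_i.\alpha_j}=q_{i,j}q_{j,i}$ for $i\ne j$; the generalized Cartan matrix satisfies, for each $i\ne j$, $q_{i,i}^{a_{i,j}}=q_{i,j}q_{j,i}$ or $q_{i,i}^{1-a_{i,j}}=1$; the two alternatives on scalar products assumed in the claim are the logarithmic lift of these, and $\mathfrak{R}^{(k)}$ is the lift of the Weyl groupoid reflection $q_{i,j}\mapsto q_{i,j}q_{i,k}^{-a_{k,j}}q_{k,j}^{-a_{k,i}}q_{k,k}^{a_{k,i}a_{k,j}}$. *)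

(* Defs.v *)
From HB Require Import structures.
From mathcomp Require Import all_boot all_order all_algebra.
From mathcomp Require Import reals complex.

Set Implicit Arguments.
Unset Strict Implicit.
Unset Printing Implicit Defensive.

Import Order.TTheory GRing.Theory Num.Theory.
Local Open Scope ring_scope.

(* Bilinear, not sesquilinear: no complex conjugation is involved. *)
Definition dotv (K : fieldType) (n : nat) (u v : 'rV[K]_n) : K :=
  \sum_(s < n) u 0 s * v 0 s.

(* Dimension of e^{mu.phi(z)} with respect to
   T_xi = 1/2 d(phi).d(phi) + xi.d^2(phi). *)
Definition vertex_dim (K : fieldType) (n : nat) (xi mu : 'rV[K]_n) : K :=
  2^-1 * dotv mu mu - dotv xi mu.

(* Central charge of the Virasoro algebra generated by the modes of T_xi. *)
Definition virasoro_charge (K : fieldType) (n : nat) (xi : 'rV[K]_n) : K :=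
  n%:R - 12 * dotv xi xi.

Definition is_screening (K : fieldType) (n : nat) (xi mu : 'rV[K]_n) : Prop :=
  vertex_dim xi mu = 1.

(* [c] is the central charge of the Virasoro algebra centralizing the
   screenings with momenta [alpha]: it is c_xi for the unique xi making every
   e^{alpha_i.phi} a field of dimension 1. *)
Definition is_centralizer_charge (K : fieldType) (n : nat)
    (alpha : n.-tuple 'rV[K]_n) (c : K) : Prop :=
  exists xi : 'rV[K]_n,
    unique (fun xi' => forall i : 'I_n, is_screening xi' (tnth alpha i)) xi
    /\ c = virasoro_charge xi.

Definition gram (K : fieldType) (n : nat) (alpha : n.-tuple 'rV[K]_n) : 'M[K]_n :=
  \matrix_(i, j) dotv (tnth alpha i) (tnth alpha j).

(* The dimension-1 conditions for xi = \sum_j x_j alpha_j, written in terms of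
   the scalar products G i j = alpha_i.alpha_j only, so that the scalar products
   can be replaced by other values. *)
Definition screening_system (K : fieldType) (n : nat) (G : 'M[K]_n)
    (x : 'rV[K]_n) : Prop :=
  forall i : 'I_n, 2^-1 * G i i - \sum_(j < n) x 0 j * G j i = 1.

Definition is_gram_charge (K : fieldType) (n : nat) (G : 'M[K]_n) (c : K) : Prop :=
  exists x : 'rV[K]_n,
    unique (screening_system G) x
    /\ c = n%:R - 12 * \sum_(l < n) \sum_(j < n) x 0 l * x 0 j * G l j.

Definition is_gen_cartan (n : nat) (a : 'M[int]_n) : Prop :=
  [/\ forall i, a i i = 2,
      forall i j, i != j -> a i j <= 0
    & forall i j, a i j = 0 -> a j i = 0].

Definition reflect_gram (K : fieldType) (n : nat) (a : 'M[int]_n) (k : 'I_n)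
    (G : 'M[K]_n) : 'M[K]_n :=
  \matrix_(i, j) (G i j - (a k j)%:~R * G i k - (a k i)%:~R * G k j
                  + (a k i)%:~R * (a k j)%:~R * G k k).

(* Main.v *)
Require Import Defs.
From HB Require Import structures.
From mathcomp Require Import all_boot all_order all_algebra.
From mathcomp Require Import reals complex.
From mathcomp Require Import ring.

Set Implicit Arguments.
Unset Strict Implicit.
Unset Printing Implicit Defensive.

Import Order.TTheory GRing.Theory Num.Theory.
Local Open Scope ring_scope.
Local Open Scope complex_scope.

(** Let [xi] be the vector for which every [alpha_i] has dimension 1.  The
    formula for the reflected scalar products is the Gram matrix of the
    pseudoreflected momenta [beta_i = alpha_i - a_(k,i) alpha_k]
    ([gram_pseudoreflect]), which are again linearly independent
    ([pseudoreflect_unit]).  A system written in terms of a Gram matrix is the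
    system of dimension-1 conditions on [xi = \sum_j x_j alpha_j], and [xi.xi] is
    its quadratic form ([gram_chargeP]); so it suffices to find the vector for
    which every [beta_i] has dimension 1 and to compare its square with [xi.xi].

    That vector is the orthogonal reflection [s_k xi] of [xi] in the hyperplane
    orthogonal to [alpha_k] ([reflected_screening]), and [s_k] is an isometry.
    To see that it solves the new system, put [g = alpha_k.alpha_k].  The
    screening condition on [alpha_k] says [2 xi.alpha_k = g - 2], so
    [s_k xi = xi - (1 - 2 / g) alpha_k], and the dimensions of [beta_j] with
    respect to [s_k xi] and of [alpha_j] with respect to [xi] differ by a product
    of two factors: one vanishes when [2 alpha_k.alpha_j = a_(k,j) g], the other
    when [(1 - a_(k,j)) g = 2].

    The reflection requires [g <> 0].  If [g = 0], the second alternative is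
    impossible, so the first one makes [alpha_k] orthogonal to every [alpha_j],
    contradicting linear independence ([momentum_anisotropic]). *)

(** * The bilinear scalar product *)

Section Dotv.
Variables (K : fieldType) (n : nat).
Implicit Types (u v w : 'rV[K]_n) (t : K).

Lemma dotvE u v : dotv u v = (u *m v^T) 0 0.
Proof. by rewrite mxE; apply: eq_bigr => s _; rewrite mxE. Qed.

Lemma dotvC u v : dotv u v = dotv v u.
Proof. by apply: eq_bigr => s _; rewrite mulrC. Qed.

Lemma dotvBl u v w : dotv (u - v) w = dotv u w - dotv v w.
Proof. by rewrite !dotvE mulmxBl !mxE. Qed.

Lemma dotvZl t u w : dotv (t *: u) w = t * dotv u w.
Proof. by rewrite !dotvE -scalemxAl mxE. Qed.

Lemma dotvBr u v w : dotv w (u - v) = dotv w u - dotv w v.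
Proof. by rewrite dotvC dotvBl !(dotvC w). Qed.

Lemma dotvZr t u w : dotv w (t *: u) = t * dotv w u.
Proof. by rewrite dotvC dotvZl dotvC. Qed.

Definition vreflect v u : 'rV[K]_n := u - (2 * dotv u v / dotv v v) *: v.

Lemma vreflect_isometry v u :
  dotv v v != 0 -> dotv (vreflect v u) (vreflect v u) = dotv u u.
Proof.
move=> v_neq0; rewrite /vreflect !(dotvBl, dotvBr, dotvZl, dotvZr) (dotvC v u).
by field.
Qed.

End Dotv.

(** * Momenta and the central charge they determine *)

Section Momenta.
Variables (K : fieldType) (n : nat).
Implicit Types (alpha : n.-tuple 'rV[K]_n) (xi x : 'rV[K]_n).

Definition momenta_mx alpha : 'M[K]_n := \matrix_(i < n) tnth alpha i.

Lemma row_momenta_mx alpha i : row i (momenta_mx alpha) = tnth alpha i.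
Proof. exact: rowK. Qed.

Lemma mulmx_momenta_tr alpha v i :
  (v *m (momenta_mx alpha)^T) 0 i = dotv v (tnth alpha i).
Proof. by rewrite mxE; apply: eq_bigr => s _; rewrite !mxE. Qed.

Lemma free_momenta_unit alpha : free alpha -> momenta_mx alpha \in unitmx.
Proof.
move=> /freeP alpha_free; rewrite -row_free_unit; apply: inj_row_free => u uA0.
apply/rowP => i; rewrite mxE; apply: (alpha_free (u 0)).
rewrite -[RHS]uA0 mulmx_sum_row; apply: eq_bigr => j _.
by rewrite row_momenta_mx (tnth_nth 0).
Qed.

(** Nondegeneracy of the scalar product: over a general field a nonzero vector
    may be isotropic, but it cannot be orthogonal to a whole basis. *)
Lemma dotv_momenta_eq0 alpha v :
  momenta_mx alpha \in unitmx -> (forall i, dotv v (tnth alpha i) = 0) -> v = 0.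
Proof.
move=> A_unit v_orth.
apply: (row_free_inj (A := (momenta_mx alpha)^T)).
  by rewrite row_free_unit unitmx_tr.
by apply/rowP => i; rewrite mul0mx mulmx_momenta_tr v_orth mxE.
Qed.

Lemma momenta_unit_orth alpha :
  (forall v, (forall i, dotv v (tnth alpha i) = 0) -> v = 0) ->
  momenta_mx alpha \in unitmx.
Proof.
move=> nondeg; rewrite -unitmx_tr -row_free_unit; apply: inj_row_free => v vA0.
by apply: nondeg => i; rewrite -mulmx_momenta_tr vA0 mxE.
Qed.

Lemma screening_exists alpha :
  momenta_mx alpha \in unitmx ->
  exists xi, forall i, is_screening xi (tnth alpha i).
Proof.
move=> A_unit.
pose b : 'rV[K]_n := \row_i (2^-1 * dotv (tnth alpha i) (tnth alpha i) - 1).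
exists (b *m invmx (momenta_mx alpha)^T) => i.
rewrite /is_screening /vertex_dim -[dotv (_ *m _) _]mulmx_momenta_tr.
rewrite mulmxKV ?unitmx_tr //.
by rewrite mxE; ring.
Qed.

Lemma screening_inj alpha xi xi' :
  momenta_mx alpha \in unitmx ->
  (forall i, is_screening xi (tnth alpha i)) ->
  (forall i, is_screening xi' (tnth alpha i)) -> xi = xi'.
Proof.
move=> A_unit scr scr'; apply/eqP; rewrite -subr_eq0; apply/eqP.
apply: (dotv_momenta_eq0 A_unit) => i; rewrite dotvBl.
have : vertex_dim xi (tnth alpha i) = vertex_dim xi' (tnth alpha i).
  by rewrite (scr i) (scr' i).
by move/addrI/oppr_inj => ->; rewrite subrr.
Qed.

Lemma centralizer_chargeP alpha xi :
  momenta_mx alpha \in unitmx ->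
  (forall i, is_screening xi (tnth alpha i)) ->
  is_centralizer_charge alpha (virasoro_charge xi).
Proof.
move=> A_unit scr; exists xi; split=> //; split=> // xi' scr'.
exact: (screening_inj A_unit).
Qed.

Lemma dotv_mul_momenta alpha x i :
  dotv (x *m momenta_mx alpha) (tnth alpha i) = \sum_j x 0 j * gram alpha j i.
Proof.
rewrite -mulmx_momenta_tr -mulmxA mxE; apply: eq_bigr => j _; congr (_ * _).
by rewrite !mxE; apply: eq_bigr => s _; rewrite !mxE.
Qed.

Lemma screening_systemP alpha x :
  screening_system (gram alpha) x <->
  forall i, is_screening (x *m momenta_mx alpha) (tnth alpha i).
Proof.
by split=> scr i; move: (scr i);
  rewrite /is_screening /vertex_dim dotv_mul_momenta mxE.
Qed.

(** Independent momenta form a basis, so [xi] has unique coordinates [x] in it,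
    and the Gram-matrix system and charge are those of [xi] in coordinates. *)
Lemma gram_chargeP alpha xi :
  momenta_mx alpha \in unitmx ->
  (forall i, is_screening xi (tnth alpha i)) ->
  is_gram_charge (gram alpha) (virasoro_charge xi).
Proof.
move=> A_unit scr; pose x := xi *m invmx (momenta_mx alpha).
have xA : x *m momenta_mx alpha = xi by rewrite mulmxKV.
exists x; split.
  split=> [|x' /screening_systemP scr']; first by apply/screening_systemP; rewrite xA.
  by rewrite /x (screening_inj A_unit scr scr') mulmxK.
rewrite /virasoro_charge; congr (_ - 12 * _).
rewrite dotvE -{2}xA trmx_mul mulmxA mxE exchange_big; apply: eq_bigr => j _ /=.
rewrite mulmx_momenta_tr -xA dotv_mul_momenta mulr_suml.
by apply: eq_bigr => l _; rewrite [x^T _ _]mxE mulrAC.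
Qed.

End Momenta.

(** * Weyl pseudoreflections *)

Section Pseudoreflection.
Variables (K : fieldType) (n : nat) (alpha : n.-tuple 'rV[K]_n).
Variables (a : 'M[int]_n) (k : 'I_n).

Definition pseudoreflect : n.-tuple 'rV[K]_n :=
  [tuple tnth alpha i - (a k i)%:~R *: tnth alpha k | i < n].

Lemma gram_pseudoreflect : gram pseudoreflect = reflect_gram a k (gram alpha).
Proof.
apply/matrixP => i j; rewrite !mxE !tnth_mktuple.
by rewrite !(dotvBl, dotvBr, dotvZl, dotvZr); ring.
Qed.

Hypothesis akk : a k k = 2.
Hypothesis alpha_unit : momenta_mx alpha \in unitmx.

(** As [a k k = 2], the [k]-th momentum is sent to its opposite; a vector
    orthogonal to all the new momenta is therefore orthogonal to [alpha_k],
    hence to all the old ones. *)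
Lemma pseudoreflect_unit : momenta_mx pseudoreflect \in unitmx.
Proof.
apply: momenta_unit_orth => v v_orth.
have vE i : dotv v (tnth alpha i) = (a k i)%:~R * dotv v (tnth alpha k).
  move: (v_orth i); rewrite tnth_mktuple dotvBr dotvZr => /eqP.
  by rewrite subr_eq0 => /eqP.
have vk0 : dotv v (tnth alpha k) = 0.
  move: (vE k); rewrite akk => vk.
  have -> : dotv v (tnth alpha k)
          = 2 * dotv v (tnth alpha k) - dotv v (tnth alpha k) by ring.
  by rewrite -vk subrr.
by apply: (dotv_momenta_eq0 alpha_unit) => i; rewrite vE vk0 mulr0.
Qed.

Hypothesis two_neq0 : (2 : K) != 0.
Hypothesis cartan_cond : forall j, k != j ->
  2 * dotv (tnth alpha k) (tnth alpha j)
    = (a k j)%:~R * dotv (tnth alpha k) (tnth alpha k)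
  \/ (1 - (a k j)%:~R) * dotv (tnth alpha k) (tnth alpha k) = 2.

Lemma momentum_anisotropic : dotv (tnth alpha k) (tnth alpha k) != 0.
Proof.
apply/eqP => akk0.
have ak0 : tnth alpha k = 0.
  apply: (dotv_momenta_eq0 alpha_unit) => j.
  have [<-//|/cartan_cond] := eqVneq k j.
  rewrite akk0 !mulr0 => -[/eqP|two0].
    by rewrite mulf_eq0 (negPf two_neq0) => /eqP.
  by move: two_neq0; rewrite -two0 eqxx.
have := row_momenta_mx alpha k; rewrite ak0 rowE => eA0.
(* A zero row is impossible in an invertible matrix. *)
have : delta_mx 0 k = 0 :> 'rV[K]_n.
  by rewrite -(mulmxK alpha_unit (delta_mx 0 k)) eA0 mul0mx.
by move/rowP/(_ k); rewrite !mxE !eqxx => /eqP; rewrite oner_eq0.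
Qed.

(** With [g = alpha_k.alpha_k], [h = alpha_k.alpha_j] and [a = a_(k,j)], the
    dimension of the new [j]-th momentum with respect to [s_k xi] is that of
    [alpha_j] with respect to [xi] plus
    [(2 h - a g) * (g - 2 - a g) / (2 g)]. *)
Lemma reflected_screening (xi : 'rV[K]_n) :
  (forall i, is_screening xi (tnth alpha i)) ->
  forall i, is_screening (vreflect (tnth alpha k) xi) (tnth pseudoreflect i).
Proof.
move=> scr j; rewrite /is_screening /vertex_dim tnth_mktuple /vreflect.
rewrite !(dotvBl, dotvBr, dotvZl, dotvZr) (dotvC (tnth alpha j) (tnth alpha k)).
have g_neq0 := momentum_anisotropic.
have cond : (2 * dotv (tnth alpha k) (tnth alpha j)
             - (a k j)%:~R * dotv (tnth alpha k) (tnth alpha k))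
          * ((1 - (a k j)%:~R) * dotv (tnth alpha k) (tnth alpha k) - 2) = 0.
  have [<-|/cartan_cond[->|->]] := eqVneq k j.
  - by rewrite akk subrr mul0r.
  - by rewrite subrr mul0r.
  - by rewrite subrr mulr0.
move: (scr k) (scr j) cond g_neq0; rewrite /is_screening /vertex_dim.
set g := dotv (tnth alpha k) _; set h := dotv (tnth alpha k) _.
set y := dotv xi (tnth alpha k); set z := dotv xi _.
set q := dotv (tnth alpha j) _; set m := (a k j)%:~R.
move=> scr_k scr_j cond g_neq0.
have yE : y = 2^-1 * g - 1 by rewrite -[X in _ = _ - X]scr_k; ring.
have zE : z = 2^-1 * q - 1 by rewrite -[X in _ = _ - X]scr_j; ring.
rewrite yE zE; apply/eqP; rewrite -subr_eq0; apply/eqP.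
transitivity ((2 * h - m * g) * ((1 - m) * g - 2) / (2 * g)).
  by field; rewrite g_neq0.
by rewrite cond mul0r.
Qed.

Lemma reflected_gram_charge (xi : 'rV[K]_n) :
  (forall i, is_screening xi (tnth alpha i)) ->
  is_gram_charge (reflect_gram a k (gram alpha)) (virasoro_charge xi).
Proof.
move=> scr; rewrite -gram_pseudoreflect.
rewrite /virasoro_charge -(vreflect_isometry xi momentum_anisotropic).
by apply: gram_chargeP; [exact: pseudoreflect_unit | exact: reflected_screening].
Qed.

End Pseudoreflection.

Theorem mainTheorem1 (R : realType) (theta : nat) (htheta : (1 <= theta)%N)
    (alpha : theta.-tuple 'rV[R[i]]_theta) (halpha : free alpha)
    (a : 'M[int]_theta) (ha : is_gen_cartan a)
    (hcond : forall i j : 'I_theta, i != j ->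
       2 * dotv (tnth alpha i) (tnth alpha j)
         = (a i j)%:~R * dotv (tnth alpha i) (tnth alpha i)
       \/ (1 - (a i j)%:~R) * dotv (tnth alpha i) (tnth alpha i) = 2) :
  exists c : R[i],
    [/\ is_centralizer_charge alpha c,
        is_gram_charge (gram alpha) c
      & forall k : 'I_theta, is_gram_charge (reflect_gram a k (gram alpha)) c].
Proof.
have alpha_unit := free_momenta_unit halpha.
have two_neq0 : (2 : R[i]) != 0 by rewrite pnatr_eq0.
have [xi scr] := screening_exists alpha_unit.
exists (virasoro_charge xi); split=> [||k].
- exact: centralizer_chargeP.
- exact: gram_chargeP.
- by case: ha => diag _ _; apply: reflected_gram_charge => //; exact: hcond.
Qed.
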